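(* There exists $\lambda \in \mathbb{C}$ such that the complex Lie algebras $\mathfrak{g}_\lambda$ and $\mathfrak{g}_{\overline{\lambda}}$ are not isomorphic (as complex Lie algebras).
   Context: For $\lambda \in \mathbb{C}$, let $\mathfrak{g}_\lambda$ be the complex ($2$-step nilpotent) Lie algebra of dimension $10$ with basis $X_1, \ldots, X_8, Z_1, Z_2$ and Lie bracket determined by $[X_1,X_5] = Z_1$, $[X_2,X_6] = Z_1$, $[X_3,X_7] = Z_1$, $[X_4,X_8] = Z_1$, $[X_2,X_5] = Z_2$, $[X_3,X_6] = Z_2$, $[X_4,X_7] = Z_2$, $[X_1,X_8] = -Z_2$, $[X_2,X_7] = -\lambda Z_2$, where all brackets of basis vectors not determined by these via antisymmetry are zero. Here $\overline{\lambda}$ denotes the complex conjugate of $\lambda$. *)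

(* Defs.v *)
From HB Require Import structures.
From mathcomp Require Import all_boot all_order all_algebra.
From mathcomp Require Export reals complex.

Set Implicit Arguments.
Unset Strict Implicit.
Unset Printing Implicit Defensive.

Import GRing.Theory.
Local Open Scope ring_scope.

HB.mixin Record Lmodule_isLieAlgebra (K : fieldType) L
    of GRing.Lmodule K L := {
  lie : L -> L -> L;
  lie_linearl : forall y : L, linear (lie ^~ y);
  lie_linearr : forall x : L, linear (lie x);
  lie_alt : forall x : L, lie x x = 0;
  lie_jacobi : forall x y z : L,
    lie x (lie y z) + lie y (lie z x) + lie z (lie x y) = 0
}.

#[short(type="lieAlgType")]
HB.structure Definition LieAlgebra (K : fieldType) :=
  { L of Lmodule_isLieAlgebra K L & GRing.Lmodule K L }.

Definition lie_isomorphic (K : fieldType) (L1 L2 : lieAlgType K) : Prop :=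
  exists f : {linear L1 -> L2},
    bijective f /\ {morph f : x y / lie x y >-> lie x y}.

(* Coordinates 0, ..., 7 are those on X_1, ..., X_8, and coordinates 8, 9 those
   on Z_1, Z_2. The phantom parameter lets the canonical Lie structure on this
   alias depend on lambda. *)
Definition glie (K : fieldType) (lambda : K) : Type := 'rV[K]_10.

HB.instance Definition _ (K : fieldType) (lambda : K) :=
  GRing.Lmodule.copy (glie lambda) 'rV[K]_10.

Section GLie.

Variables (K : fieldType) (lambda : K).
Local Notation g := (glie lambda).

(* Meaningful for 1 <= i <= 8 and 1 <= k <= 2 respectively. *)
Definition Xvec (i : nat) : g := delta_mx 0 (inord i.-1 : 'I_10).
Definition Zvec (k : nat) : g := delta_mx 0 (inord (7 + k) : 'I_10).

(* Only one order of each pair is listed: numbering the basis from 1 to 10, the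
   bracket of the i-th and j-th vectors is gtable i j - gtable j i. *)
Definition gtable (i j : nat) : g :=
  match i, j with
  | 1, 5 | 2, 6 | 3, 7 | 4, 8 => Zvec 1
  | 2, 5 | 3, 6 | 4, 7 => Zvec 2
  | 1, 8 => - Zvec 2
  | 2, 7 => - (lambda *: Zvec 2)
  | _, _ => 0
  end.

Definition gbracket (x y : g) : g :=
  \sum_(i < 10) \sum_(j < 10)
    (x 0 i * y 0 j) *: (gtable i.+1 j.+1 - gtable j.+1 i.+1).

Lemma gbracket_linearl (y : g) : linear (gbracket ^~ y).
Proof.
move=> a u v; rewrite /gbracket scaler_sumr -big_split /=.
apply: eq_bigr => i _; rewrite scaler_sumr -big_split /=.
by apply: eq_bigr => j _; rewrite !mxE mulrDl scalerDl scalerA mulrA.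
Qed.

Lemma gbracket_anti (x y : g) : gbracket x y = - gbracket y x.
Proof.
rewrite /gbracket exchange_big -sumrN; apply: eq_bigr => i _.
rewrite -sumrN; apply: eq_bigr => j _.
by rewrite mulrC -scalerN opprB.
Qed.

Lemma gbracket_linearr (x : g) : linear (gbracket x).
Proof.
move=> a u v; rewrite gbracket_anti gbracket_linearl opprD -scalerN.
by rewrite -!gbracket_anti.
Qed.

Lemma gbracket_alt (x : g) : gbracket x x = 0.
Proof.
rewrite /gbracket.
under eq_bigr => i _ do under eq_bigr => j _ do rewrite scalerBr.
under eq_bigr => i _ do rewrite sumrB.
rewrite sumrB [X in _ - X]exchange_big /=; apply/eqP; rewrite subr_eq0.
apply/eqP/eq_bigr => i _; apply: eq_bigr => j _.
by rewrite mulrC.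
Qed.

Lemma Zvec_coord (n : nat) (k : 'I_10) :
  (0 < n <= 2)%N -> (k < 8)%N -> Zvec n 0 k = 0.
Proof.
case: n => [|[|[|n]]] // _ k8; rewrite /Zvec mxE eqxx /=;
by case: eqP => // kE; move: k8; rewrite kE inordK.
Qed.

Lemma gtable_coord (i j : nat) (k : 'I_10) : (k < 8)%N -> gtable i j 0 k = 0.
Proof.
move=> k8; have Z0 n (n12 : (0 < n <= 2)%N) := Zvec_coord n12 k8.
rewrite /gtable.
by repeat match goal with |- context [match ?x with O => _ | S _ => _ end] =>
  destruct x end;
  first [by rewrite Z0 | by rewrite [LHS]mxE
       | by rewrite [LHS]mxE Z0 // oppr0
       | by rewrite [LHS]mxE [X in - X]mxE Z0 // mulr0 oppr0].
Qed.

Lemma gbracket_coord (x y : g) (k : 'I_10) :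
  (k < 8)%N -> gbracket x y 0 k = 0.
Proof.
move=> k8; rewrite /gbracket summxE big1 // => i _; rewrite summxE big1 // => j _.
by rewrite mxE mxE [X in _ + X]mxE !gtable_coord // subr0 mulr0.
Qed.

Lemma gtable_gt8 (i j : nat) : (8 < maxn i j)%N -> gtable i j = 0.
Proof.
rewrite /gtable => ij; move: ij.
by repeat match goal with |- context [match ?x with O => _ | S _ => _ end] =>
  destruct x end.
Qed.

Lemma gbracket_center (x z : g) :
  (forall k : 'I_10, (k < 8)%N -> z 0 k = 0) -> gbracket x z = 0.
Proof.
move=> z0; rewrite /gbracket big1 // => i _; rewrite big1 // => j _.
have [j8|j8] := ltnP j 8; first by rewrite z0 // mulr0 scale0r.
by rewrite !gtable_gt8 ?subr0 ?scaler0 // leq_max !ltnS j8 ?orbT.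
Qed.

Lemma gbracket2 (x y z : g) : gbracket x (gbracket y z) = 0.
Proof. by apply: gbracket_center => k; apply: gbracket_coord. Qed.

Lemma gbracket_jacobi (x y z : g) :
  gbracket x (gbracket y z) + gbracket y (gbracket z x)
    + gbracket z (gbracket x y) = 0.
Proof. by rewrite !gbracket2 !addr0. Qed.

HB.instance Definition _ := Lmodule_isLieAlgebra.Build K g
  gbracket_linearl gbracket_linearr gbracket_alt gbracket_jacobi.

Lemma lie_delta (i j : 'I_10) :
  lie (delta_mx 0 i : g) (delta_mx 0 j : g)
    = gtable i.+1 j.+1 - gtable j.+1 i.+1.
Proof.
rewrite /lie /= /gbracket (bigD1 i) //= (bigD1 j) //= !mxE !eqxx mulr1 scale1r.
rewrite big1 => [|k /negPf kj]; last by rewrite !mxE kj andbF mulr0 scale0r.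
rewrite addr0 big1 ?addr0 // => k /negPf ki.
by rewrite big1 // => l _; rewrite !mxE ki andbF mul0r scale0r.
Qed.

Lemma lie_Xvec (i j : nat) : (0 < i <= 8)%N -> (0 < j <= 8)%N ->
  lie (Xvec i) (Xvec j) = gtable i j - gtable j i.
Proof.
case: i j => [|i] [|j] // i8 j8.
by rewrite lie_delta /= !inordK // ?(leq_trans i8) ?(leq_trans j8).
Qed.

Lemma lie_Zvec (k : nat) (x : g) : (0 < k <= 2)%N -> lie x (Zvec k) = 0.
Proof. by move=> k12; apply: gbracket_center => l; apply: Zvec_coord. Qed.

End GLie.

(* Main.v *)
(** The brackets of [g_lambda] form a pencil of alternating forms on an
8-dimensional space, valued in the 2-dimensional span of [Z_1], [Z_2]. The
Pfaffian of the pencil is the binary quartic [s^4 + lambda s^2 t^2 + t^4], so an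
isomorphism induces a linear substitution that carries one quartic to a multiple
of the other. The quotient [I^3 / J^2] of the classical invariants of degrees 2
and 3 is then unchanged; it is a rational function of [lambda] with rational
coefficients, and it is not real at [lambda = 1 + i]. Determinants, which are
squares of Pfaffians, determine the quartics up to a sign, and that sign is
absorbed by the scalar multiple. *)

Require Import Defs.
From mathcomp Require Import all_boot all_order all_algebra.
From mathcomp Require Import ring.

Set Implicit Arguments.
Unset Strict Implicit.
Unset Printing Implicit Defensive.

Import GRing.Theory Num.Theory.
Local Open Scope ring_scope.

(** * The pencil of alternating forms and its determinant *)

(* Entry (i, j) is the value of s Z_1^* + t Z_2^* at [X_(i+1), X_(j+5)]. *)
Definition pencil (S : comNzRingType) (lambda s t : S) : 'M[S]_4 :=
  \matrix_(i, j) (if i == j then s else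
    if (i == j.+1 :> nat) then t else
    if (i == 0 :> nat) && (j == 3 :> nat) then - t else
    if (i == 1 :> nat) && (j == 2 :> nat) then - (t * lambda) else 0).

(** The form [s Z_1^* + t Z_2^*] of the bracket on the span of the [X_i]; the diagonal blocks vanish
    because [X_1, ..., X_4] commute among themselves, as do [X_5, ..., X_8]. *)
Definition gram (S : comNzRingType) (lambda s t : S) : 'M[S]_(4 + 4) :=
  block_mx 0 (pencil lambda s t) (- (pencil lambda s t)^T) 0.

Definition quartic (S : comNzRingType) (lambda s t : S) : S :=
  s ^+ 4 + lambda * s ^+ 2 * t ^+ 2 + t ^+ 4.

Lemma det_pencil (S : comNzRingType) (lambda s t : S) :
  \det (pencil lambda s t) = quartic lambda s t.
Proof.
rewrite (expand_det_row _ ord0) !big_ord_recl big_ord0.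
rewrite ![pencil _ _ _ _ _]mxE /= !mul0r !add0r addr0 /cofactor.
rewrite !(expand_det_row _ ord0) !big_ord_recl !big_ord0 /cofactor.
rewrite !(expand_det_row _ ord0) !big_ord_recl !big_ord0 /cofactor.
rewrite !det_mx11 !mxE /= /bump /= /quartic.
ring.
Qed.

Lemma det_gram (S : comNzRingType) (lambda s t : S) :
  \det (gram lambda s t) = quartic lambda s t ^+ 2.
Proof.
have flip : gram lambda s t *m block_mx 0 1%:M (- 1%:M) 0
    = block_mx (- pencil lambda s t) 0 0 (- (pencil lambda s t)^T).
  by rewrite mulmx_block !mul0mx !mulmx0 !addr0 !add0r mulmxN !mulmx1.
have det_swap : \det (block_mx 0 1%:M (- 1%:M) 0 : 'M[S]_(4 + 4)) = 1.
  (* The block swap is a product of three unipotent block triangular matrices. *)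
  have <- : block_mx 1%:M 1%:M 0 1%:M *m block_mx 1%:M 0 (- 1%:M) 1%:M
      *m block_mx 1%:M 1%:M 0 1%:M = block_mx 0 1%:M (- 1%:M) 0 :> 'M[S]_(4 + 4).
    rewrite !mulmx_block !mul0mx !mulmx0 !mulmx1 !mul1mx.
    by rewrite !addr0 !add0r subrr add0r addNr.
  by rewrite !det_mulmx !det_ublock det_lblock !det1 !mulr1.
have := congr1 determinant flip.
rewrite det_mulmx det_swap mulr1 det_ublock -!scaleN1r !detZ det_tr det_pencil.
by move=> ->; ring.
Qed.

Lemma map_gram (S T : comNzRingType) (f : {rmorphism S -> T}) (lambda s t : S) :
  map_mx f (gram lambda s t) = gram (f lambda) (f s) (f t).
Proof.
rewrite map_block_mx !map_mx0 map_mxN -map_trmx.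
suff -> : map_mx f (pencil lambda s t) = pencil (f lambda) (f s) (f t) by [].
apply/matrixP=> i j; rewrite !mxE.
by do 4?case: ifP => _; rewrite ?rmorphN ?rmorphM ?rmorph0.
Qed.

Lemma gram_linear (S : comNzRingType) (lambda s t : S) :
  gram lambda s t = s *: gram lambda 1 0 + t *: gram lambda 0 1.
Proof.
rewrite !scale_block_mx add_block_mx !scaler0 !addr0 !scalerN -opprD.
rewrite -!linearZ -linearD.
suff <- : pencil lambda s t = s *: pencil lambda 1 0 + t *: pencil lambda 0 1 by [].
apply/matrixP=> i j; rewrite !mxE.
do 4?case: ifP => _; ring.
Qed.

Lemma gram_congruence (S : comNzRingType) (lambda mu a b c d s t : S)
    (H : 'M[S]_(4 + 4)) :
  H *m gram mu 1 0 *m H^T = gram lambda a c ->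
  H *m gram mu 0 1 *m H^T = gram lambda b d ->
  H *m gram mu s t *m H^T = gram lambda (s * a + t * b) (s * c + t * d).
Proof.
move=> E10 E01.
rewrite gram_linear mulmxDr mulmxDl -!scalemxAr -!scalemxAl E10 E01.
rewrite (gram_linear _ a) (gram_linear _ b) (gram_linear _ (_ + _)).
by rewrite !scalerDr !scalerA addrACA -!scalerDl.
Qed.

(** * Brackets in coordinates *)

Section Bracket.
Variables (K : fieldType) (lambda : K).
Implicit Types x y : glie lambda.

Local Arguments gtable : simpl never.

Lemma Zvec_entry (n : nat) (k : 'I_10) :
  (n <= 2)%N -> Zvec lambda n 0 k = (k == 7 + n :> nat)%:R.
Proof. by move=> n2; rewrite mxE eqxx -val_eqE /= inordK // (leq_add2l 7 n 2). Qed.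

Lemma gtable_gram (i j : 'I_(4 + 4)) (s t : K) :
  s * (gtable lambda i.+1 j.+1 - gtable lambda j.+1 i.+1) 0 (inord 8)
    + t * (gtable lambda i.+1 j.+1 - gtable lambda j.+1 i.+1) 0 (inord 9)
  = gram lambda s t i j.
Proof.
rewrite ![(_ - _ : 'rV_10) _ _]mxE ![(- _ : 'rV_10) _ _]mxE.
have oE (k : 'I_10) : (0 : glie lambda) 0 k = 0 by rewrite mxE.
have nE (u : glie lambda) (k : 'I_10) : (- u) 0 k = - u 0 k by rewrite mxE.
have aE (u : glie lambda) (k : 'I_10) : (lambda *: u) 0 k = lambda * u 0 k by rewrite mxE.
rewrite -(splitK i) -(splitK j).
case: (split i) (split j) => [] {}i [] {}j;
  rewrite /= ?block_mxEul ?block_mxEur ?block_mxEdl ?block_mxEdr !mxE.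
all: case: i => [[|[|[|[|?]]]] ?] //; case: j => [[|[|[|[|?]]]] ?] //.
all: rewrite /gtable /= ?nE ?aE ?Zvec_entry ?oE ?inordK //=; ring.
Qed.

Lemma lie_gram x y (s t : K) :
  s * lie x y 0 (inord 8) + t * lie x y 0 (inord 9) =
  \sum_(i < 4 + 4) \sum_(j < 4 + 4)
    x 0 (lshift 2 i) * y 0 (lshift 2 j) * gram lambda s t i j.
Proof.
rewrite /lie /= /gbracket !summxE !mulr_sumr -big_split /=.
(* Indices 8 and 9 belong to the central vectors [Z_1], [Z_2] and contribute nothing. *)
rewrite (@big_split_ord _ _ _ 8 2) /= [X in _ + X]big1 ?addr0; last first.
  move=> i _; rewrite !summxE !mulr_sumr -big_split big1 //= => j _.
  by rewrite !gtable_gt8 ?leq_max ?orbT //= subrr scaler0 !mxE !mulr0 addr0.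
apply: eq_bigr => i _.
rewrite !summxE !mulr_sumr -big_split (@big_split_ord _ _ _ 8 2) /=.
rewrite [X in _ + X]big1 ?addr0; last first.
  move=> j _.
  by rewrite !gtable_gt8 ?leq_max ?orbT //= subrr scaler0 !mxE !mulr0 addr0.
apply: eq_bigr => j _; rewrite -gtable_gram.
have scaleE (a : K) (u : glie lambda) (k : 'I_10) : (a *: u) 0 k = a * u 0 k.
  by rewrite mxE.
by rewrite !scaleE mulrCA [t * _]mulrCA -mulrDr.
Qed.

Lemma lieE x y : lie x y =
  lie x y 0 (inord 8) *: Zvec lambda 1 + lie x y 0 (inord 9) *: Zvec lambda 2.
Proof.
apply/rowP=> k; rewrite [RHS]mxE ![(_ *: _ : 'rV_10) _ _]mxE.
have [k8|k8] := ltnP k 8; first by rewrite !Zvec_coord // gbracket_coord // !mulr0 addr0.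
rewrite !Zvec_entry //.
case: k k8 => [[|[|[|[|[|[|[|[|[|[|?]]]]]]]]]] k10] //= _.
  by rewrite mulr1 mulr0 addr0; congr (lie x y 0 _); apply: val_inj; rewrite /= inordK.
by rewrite mulr1 mulr0 add0r; congr (lie x y 0 _); apply: val_inj; rewrite /= inordK.
Qed.

End Bracket.

(** * Matrices induced by a Lie algebra morphism *)

Section Isomorphism.

Variables (K : fieldType) (lambda mu : K).
Variable f : {linear glie lambda -> glie mu}.
Hypothesis f_lie : {morph f : x y / lie x y >-> lie x y}.

Definition head_mx : 'M[K]_(4 + 4) :=
  \matrix_(i < 4 + 4, j < 4 + 4) f (Xvec lambda i.+1) 0 (lshift 2 j).

Definition center_mx : 'M[K]_2 :=
  \matrix_(k, l) f (Zvec lambda k.+1) 0 (inord (8 + l)).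

(** Apply [s Z_1^* + t Z_2^*] to [f [X_i, X_j] = [f X_i, f X_j]]: the right side only sees the
    [X]-parts of the images, and on the left the functional is pulled back through [center_mx]. *)
Lemma head_mx_gram (s t : K) :
  head_mx *m gram mu s t *m head_mx^T =
  gram lambda (s * center_mx 0 0 + t * center_mx 0 1)
              (s * center_mx 1 0 + t * center_mx 1 1).
Proof.
apply/matrixP=> i j.
pose x := Xvec lambda i.+1.
pose y := Xvec lambda j.+1.
transitivity (s * lie (f x) (f y) 0 (inord 8) + t * lie (f x) (f y) 0 (inord 9)).
  rewrite lie_gram mxE exchange_big; apply: eq_bigr => l _ /=.
  rewrite !mxE mulr_suml; apply: eq_bigr => k _.
  by rewrite !mxE mulrAC.
rewrite -f_lie [lie x y]lieE linearD !linearZ /=.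
have lie_xy : lie x y = gtable lambda i.+1 j.+1 - gtable lambda j.+1 i.+1.
  by apply: lie_Xvec; exact: ltn_ord.
have lin (a b : K) (u v : glie mu) k : (a *: u + b *: v) 0 k = a * u 0 k + b * v 0 k.
  by rewrite !mxE.
rewrite !lin -gtable_gram -lie_xy !mxE /= !addn0 !addn1.
ring.
Qed.

Lemma lie_Zvec1 : Zvec lambda 1 = lie (Xvec lambda 1) (Xvec lambda 5).
Proof. by rewrite lie_Xvec // subr0. Qed.

Lemma lie_Zvec2 : Zvec lambda 2 = lie (Xvec lambda 2) (Xvec lambda 5).
Proof. by rewrite lie_Xvec // subr0. Qed.

(** Each [Z_k] is a bracket, hence so is its image, which therefore has no [X]-part. *)
Lemma f_Zvec (k : 'I_2) :
  f (Zvec lambda k.+1) = center_mx k 0 *: Zvec mu 1 + center_mx k 1 *: Zvec mu 2.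
Proof.
have -> : center_mx k 0 = f (Zvec lambda k.+1) 0 (inord 8) by rewrite mxE.
have -> : center_mx k 1 = f (Zvec lambda k.+1) 0 (inord 9) by rewrite mxE.
case: k => [[|[|?]] ?] //=; rewrite ?lie_Zvec1 ?lie_Zvec2 f_lie; exact: lieE.
Qed.

Lemma det_center_mx_neq0 : injective f -> \det center_mx != 0.
Proof.
move=> f_inj; apply/det0P=> -[v v0 vM].
have : v 0 0 *: Zvec lambda 1 + v 0 1 *: Zvec lambda 2 = 0.
  apply: f_inj; rewrite linear0 linearD !linearZ /=.
  rewrite (f_Zvec 0) (f_Zvec 1) !scalerDr !scalerA addrACA -!scalerDl.
  have vME (l : 'I_2) : v 0 0 * center_mx 0 l + v 0 1 * center_mx 1 l = 0.
    move/rowP/(_ l): vM; rewrite mxE !big_ord_recl big_ord0 addr0 [RHS]mxE => <-.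
    by congr (_ + v 0 _ * center_mx _ l); apply: val_inj.
  by rewrite !vME !scale0r addr0.
move/rowP=> vZ; case/negP: v0; apply/eqP/rowP=> k; rewrite [RHS]mxE.
move: (vZ (inord (8 + k))); rewrite !mxE !eqxx -!val_eqE /= !inordK ?ltn_add2l //.
case: k => [[|[|?]] ?] //=; rewrite ?(mulr1, mulr0, addr0, add0r) => <-;
  congr (v 0 _); exact: val_inj.
Qed.

End Isomorphism.

(** * Invariants of the binary quartic *)

Lemma det_mx2 (S : comNzRingType) (A : 'M[S]_2) :
  \det A = A 0 0 * A 1 1 - A 0 1 * A 1 0.
Proof.
rewrite (expand_det_row _ ord0) !big_ord_recl big_ord0 addr0 /cofactor.
rewrite !det_mx11 !mxE /= expr0 expr1 mul1r mulN1r mulrN.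
by congr (A _ _ * A _ _ - A _ _ * A _ _); apply: val_inj.
Qed.

(** Forms are dehomogenized at [t = 1]. A substitution of determinant [D] multiplies I by [D^4] and
    J by [D^6]; scaling a form by [e] multiplies them by [e^2] and [e^3]. *)
Lemma quartic_invariants (K : fieldType) (lambda mu p q r w e : K) :
  quartic lambda%:P (p%:P * 'X + q%:P) (r%:P * 'X + w%:P) = e%:P * quartic mu%:P 'X 1 ->
  (12 + lambda ^+ 2) * (p * w - q * r) ^+ 4 = e ^+ 2 * (12 + mu ^+ 2) /\
  (72 * lambda - 2 * lambda ^+ 3) * (p * w - q * r) ^+ 6 = e ^+ 3 * (72 * mu - 2 * mu ^+ 3).
Proof.
set c4 := p ^+ 4 + lambda * p ^+ 2 * r ^+ 2 + r ^+ 4.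
set c3 := 4 * p ^+ 3 * q + 2 * lambda * p * r * (p * w + q * r) + 4 * r ^+ 3 * w.
set c2 := 6 * p ^+ 2 * q ^+ 2 + lambda * (p ^+ 2 * w ^+ 2 + 4 * p * q * r * w + q ^+ 2 * r ^+ 2)
          + 6 * r ^+ 2 * w ^+ 2.
set c1 := 4 * p * q ^+ 3 + 2 * lambda * q * w * (p * w + q * r) + 4 * r * w ^+ 3.
set c0 := q ^+ 4 + lambda * q ^+ 2 * w ^+ 2 + w ^+ 4.
have -> : quartic lambda%:P (p%:P * 'X + q%:P) (r%:P * 'X + w%:P)
        = Poly [:: c0; c1; c2; c3; c4].
  rewrite /quartic /= !cons_poly_def; rewrite /c0 /c1 /c2 /c3 /c4; ring.
have -> : e%:P * quartic mu%:P 'X 1 = Poly [:: e; 0; e * mu; 0; e].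
  rewrite /quartic /= !cons_poly_def; ring.
move=> /polyP E.
move: (E 0%N) (E 1%N) (E 2%N) (E 3%N) (E 4%N); rewrite !coef_Poly /=.
move=> E0 E1 E2 E3 E4; split.
  (* The invariant I = 12ae - 3bd + c^2 of a s^4 + b s^3 t + c s^2 t^2 + d s t^3 + e t^4. *)
  transitivity (12 * c4 * c0 - 3 * c3 * c1 + c2 ^+ 2).
    by rewrite /c0 /c1 /c2 /c3 /c4; ring.
  by rewrite E0 E1 E2 E3 E4; ring.
(* The invariant J = 72ace + 9bcd - 27ad^2 - 27eb^2 - 2c^3. *)
transitivity (72 * c4 * c2 * c0 + 9 * c3 * c2 * c1 - 27 * c4 * c1 ^+ 2
    - 27 * c0 * c3 ^+ 2 - 2 * c2 ^+ 3).
  by rewrite /c0 /c1 /c2 /c3 /c4; ring.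
by rewrite E0 E1 E2 E3 E4; ring.
Qed.

(** Equality of the quotients [I^3 / J^2], cross-multiplied so that J may vanish. *)
Lemma isomorphic_invariants (K : fieldType) (lambda mu : K) :
  lie_isomorphic (glie lambda) (glie mu) ->
  (12 + lambda ^+ 2) ^+ 3 * (72 * mu - 2 * mu ^+ 3) ^+ 2 =
  (12 + mu ^+ 2) ^+ 3 * (72 * lambda - 2 * lambda ^+ 3) ^+ 2.
Proof.
case=> f [/bij_inj f_inj f_lie].
have delta_neq0 := det_center_mx_neq0 f_lie f_inj.
have gram_s := head_mx_gram f_lie 1 0; have gram_t := head_mx_gram f_lie 0 1.
rewrite !(mul1r, mul0r, addr0, add0r) in gram_s gram_t.
set M := center_mx f in delta_neq0 gram_s gram_t.
pose H := map_mx (@polyC K) (head_mx f).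
have gramX : H *m gram mu%:P 'X 1 *m H^T = gram lambda%:P
    ('X * (M 0 0)%:P + 1 * (M 0 1)%:P) ('X * (M 1 0)%:P + 1 * (M 1 1)%:P).
  apply: gram_congruence.
    by rewrite -[1]/(1%:P) -[0]/(0%:P) -!map_gram map_trmx -!map_mxM gram_s.
  by rewrite -[1]/(1%:P) -[0]/(0%:P) -!map_gram map_trmx -!map_mxM gram_t.
rewrite !mul1r !['X * _]mulrC in gramX.
have /eqP := congr1 determinant gramX.
(* Squares agree in the domain [{poly K}], so the quartics agree up to the factor [h] and a sign;
   [h] is constant because [H] has constant entries. *)
rewrite !det_mulmx det_tr !det_gram mulrAC -expr2 -exprMn eq_sym eqf_sqr.
rewrite det_map_mx -mulNr -rmorphN.
set h := \det _ => quarticE.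
have [e] : exists e, quartic lambda%:P ((M 0 0)%:P * 'X + (M 0 1)%:P)
    ((M 1 0)%:P * 'X + (M 1 1)%:P) = e%:P * quartic mu%:P 'X 1.
  by case/orP: quarticE => /eqP ->; [exists h | exists (- h)].
move=> /quartic_invariants [].
rewrite -det_mx2.
set d := \det M in delta_neq0 *; move=> I_eq J_eq.
(* The single ratio [e / d^2] enters I squared and J cubed, so it cancels in [I^3 / J^2]. *)
have I_scaled : 12 + lambda ^+ 2 = (e / d ^+ 2) ^+ 2 * (12 + mu ^+ 2).
  by apply: (mulIf (expf_neq0 4 delta_neq0)); rewrite I_eq; field.
have J_scaled : 72 * lambda - 2 * lambda ^+ 3 = (e / d ^+ 2) ^+ 3 * (72 * mu - 2 * mu ^+ 3).
  by apply: (mulIf (expf_neq0 6 delta_neq0)); rewrite J_eq; field.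
rewrite I_scaled J_scaled; ring.
Qed.

(** * The value at [1 + i] *)

Theorem proposition5p2 (R : realType) :
  exists lambda : R[i], ~ lie_isomorphic (glie lambda) (glie (conjc lambda)).
Proof.
exists (1 + 'i%C).
have conj_lambda : conjc (1 + 'i%C) = 1 - 'i%C :> R[i].
  by apply/eqP; rewrite eq_complex /= addr0 subr0 add0r sub0r !eqxx.
have i2 : 'i%C ^+ 2 = -1 :> R[i] by rewrite sqr_i.
move/isomorphic_invariants.
rewrite conj_lambda; move: 'i%C i2 => z i2 /eqP; rewrite -subr_eq0.
(* The two terms are complex conjugate, so their difference is [2 i] times the imaginary part of the
   first; only [z^2 = -1] is needed to compute it. *)
have -> : (12 + (1 + z) ^+ 2) ^+ 3 * (72 * (1 - z) - 2 * (1 - z) ^+ 3) ^+ 2 -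
  (12 + (1 - z) ^+ 2) ^+ 3 * (72 * (1 + z) - 2 * (1 + z) ^+ 3) ^+ 2
    = - (z * (1024 * 81 * 371)).
  by ring: i2.
apply/negP; rewrite oppr_eq0 !mulf_neq0 ?pnatr_eq0 //.
by apply: contra_eq_neq i2 => ->; rewrite expr0n /= eq_sym oppr_eq0 oner_eq0.
Qed.
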